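(* Let $H$ and $H'$ be non-isomorphic regular $k$-uniform hypergraphs (for the same $k\ge2$). If $H$ and $H'$ are $A$-cospectral, then the subdivision hypergraphs $S(H)$ and $S(H')$ are non-isomorphic and $A$-cospectral.
   Context: A hypergraph consists of a finite vertex set and hyperedges, which are vertex subsets of size at least $2$, every vertex lying in at least one hyperedge. It is $k$-uniform if all hyperedges have $k$ vertices and regular if all vertices lie in the same number of hyperedges. For a $k$-uniform hypergraph with vertices $v_1,\dots,v_N$, the adjacency matrix $A$ has $A_{ij}=\frac{d_{ij}}{k-1}$ for $i\neq j$, where $d_{ij}$ is the number of hyperedges containing both $v_i$ and $v_j$, and $A_{ii}=0$. Two hypergraphs are $A$-cospectral if their adjacency matrices have the same multiset of eigenvalues. Subdivision of a hyperedge $e$ of cardinality $k$: add a new vertex $p_e$, delete $e$, and add the $k$ hyperedges $\{p_e\}\cup(e\setminus\{v\})$, $v\in e$. The subdivision hypergraph $S(H)$ is obtained by subdividing every hyperedge of $H$. *)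

(* Defs.v *)
From mathcomp Require Import all_boot all_order all_algebra all_field.

Set Implicit Arguments.
Unset Strict Implicit.
Unset Printing Implicit Defensive.

Import GRing.Theory.

Record hypergraph := Hypergraph {
  vertex : finType;
  hyperedges : {set {set vertex}};
  card_hyperedge : forall e, e \in hyperedges -> 2 <= #|e|;
  vertex_covered : forall v : vertex, exists2 e, e \in hyperedges & v \in e
}.

Definition uniform (k : nat) (H : hypergraph) : Prop :=
  forall e, e \in hyperedges H -> #|e| = k.

Definition degree (H : hypergraph) (v : vertex H) : nat :=
  #|[set e in hyperedges H | v \in e]|.

Definition regular (H : hypergraph) : Prop :=
  exists r : nat, forall v : vertex H, degree v = r.

Definition isomorphic (H H' : hypergraph) : Prop :=
  exists2 f : vertex H -> vertex H', bijective f &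
    forall e : {set vertex H},
      (f @: e \in hyperedges H') = (e \in hyperedges H).

Definition codegree (H : hypergraph) (u v : vertex H) : nat :=
  #|[set e in hyperedges H | (u \in e) && (v \in e)]|.

(* Meant for k-uniform H.  The entries are rational, so every complex        *)
(* eigenvalue of this matrix already lies in algC.                            *)
Definition adjacency (k : nat) (H : hypergraph) : 'M[algC]_#|vertex H| :=
  (\matrix_(i, j) if i == j then 0
                  else (codegree (enum_val i) (enum_val j))%:R / k.-1%:R)%R.

(* Algebraic multiplicity; it is 0 when a is not an eigenvalue.               *)
Definition eigen_mult (n : nat) (A : 'M[algC]_n) (a : algC) : nat :=
  mup a (char_poly A).

Lemma eigen_mult_gt0 (n : nat) (A : 'M[algC]_n) (a : algC) :
  (0 < eigen_mult A a) = eigenvalue A a.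
Proof.
by rewrite eigenvalue_root_char /eigen_mult mup_geq ?expr1 ?dvdp_XsubCl
  // monic_neq0 ?char_poly_monic.
Qed.

Definition cospectral (k : nat) (H H' : hypergraph) : Prop :=
  forall a : algC,
    eigen_mult (adjacency k H) a = eigen_mult (adjacency k H') a.

Section Subdivision.

Variable H : hypergraph.

Local Notation edge := {e : {set vertex H} | e \in hyperedges H}.

(* inl v is an old vertex v and inr e is the new vertex p_e.                  *)
Definition sub_vertex : finType :=
  (vertex H + edge)%type.

Definition sub_hyperedge (e : edge) (v : vertex H) : {set sub_vertex} :=
  inr e |: [set inl u | u in val e :\ v].

Definition sub_hyperedges : {set {set sub_vertex}} :=
  [set sub_hyperedge e v | e in {: edge}, v in val e].

Lemma card_sub_hyperedge (e : edge) (v : vertex H) :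
  v \in val e -> #|sub_hyperedge e v| = #|val e|.
Proof.
move=> ve; rewrite /sub_hyperedge cardsU1 card_imset; last by move=> x y [].
rewrite (cardsD1 v (val e)) ve; congr (_ + _).
by case: imsetP => // -[].
Qed.

Lemma sub_hyperedges_ge2 (f : {set sub_vertex}) :
  f \in sub_hyperedges -> 2 <= #|f|.
Proof.
case/imset2P=> e v _ ve ->; rewrite card_sub_hyperedge //.
exact: card_hyperedge (valP e).
Qed.

Lemma sub_vertex_covered (x : sub_vertex) :
  exists2 f, f \in sub_hyperedges & x \in f.
Proof.
case: x => [v|e].
  have [e eH ve] := vertex_covered v.
  have /card_gt0P[u] : 0 < #|e :\ v|.
    by have := card_hyperedge eH; rewrite (cardsD1 v e) ve.
  rewrite in_setD1 => /andP[uv ue].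
  exists (sub_hyperedge (Sub e eH) u); first by apply: imset2_f.
  by rewrite in_setU1; apply/orP; right; rewrite imset_f // in_setD1 eq_sym uv.
have /card_gt0P[u ue] : 0 < #|val e|.
  exact: ltnW (card_hyperedge (valP e)).
by exists (sub_hyperedge e u); [apply: imset2_f | rewrite in_setU1 eqxx].
Qed.

Definition subdivision : hypergraph :=
  Hypergraph sub_hyperedges_ge2 sub_vertex_covered.

End Subdivision.

Lemma uniform_subdivision (k : nat) (H : hypergraph) :
  uniform k H -> uniform k (subdivision H).
Proof.
move=> Hk f /imset2P[e v _ ve ->]; rewrite card_sub_hyperedge //.
exact: Hk (valP e).
Qed.

(* Main.v *)
(* In block form, with B the incidence matrix, the adjacency matrix of S(H)   *)
(* is [[(k-2) A, B], [B^T, 0]], and B B^T = r I + (k-1) A.  A Schur           *)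
(* complement then expresses the characteristic polynomial of S(H) through    *)
(* that of A, r, k and the numbers of vertices and hyperedges; r itself is    *)
(* the spectral radius of A.                                                  *)
(* In S(H) the new vertices have degree k and the old ones degree r (k - 1),  *)
(* so an isomorphism of subdivisions respects both kinds, hence comes from an *)
(* isomorphism of the hypergraphs, unless r (k - 1) = k, i.e. k = r = 2.  In  *)
(* that case H is a union of cycles, and an orientation of these cycles turns *)
(* the components where the two kinds are exchanged into ones where they are  *)
(* not.                                                                       *)
Require Import Defs.
From mathcomp Require Import all_boot all_order all_algebra all_field.
From mathcomp Require Import perm zify ring.

Set Implicit Arguments.
Unset Strict Implicit.
Unset Printing Implicit Defensive.

(** Write n and m for the numbers of vertices and hyperedges. The spectrum of A determines n as the
    degree of the characteristic polynomial and, by regularity, r as the spectral radius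
    ([cospectral_degree]); then n r = m k determines m. The formula of [char_poly_subdivision] gives
    the characteristic polynomial of S(H) at all but at most two points from that of A and from n,
    m, r, k only, so cospectrality passes to the subdivisions.

    Non-isomorphism is proved by contraposition ([isomorphic_subdivision]). An isomorphism of
    subdivisions is used only as a bijection f preserving codegrees. If r (k - 1) differs from k,
    codegrees on the diagonal, that is degrees, separate old vertices from new ones, and f restricts
    to an isomorphism of H and H' ([reconstruct_generic]). Otherwise k = r = 2, and f may send old
    vertices to new ones. An injective choice t of an end of each edge of H' turns such an image p_e
    into the old vertex t e, and the resulting map is again an isomorphism ([reconstruct_cycles]).
    The choice t comes from a 2-colouring of the flags (vertex, edge), obtained from two
    fixed-point-free involutions. *)

Lemma card2_other (T : finType) (A : {set T}) (x : T) :
  #|A| = 2 -> x \in A -> exists2 y, y != x & A = [set x; y].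
Proof.
move=> A2 xA; have /eqP/cards1P[y Ay] : #|A :\ x| = 1.
  by have := cardsD1 x A; rewrite xA A2; lia.
exists y; last by rewrite -Ay setD1K.
by have := set11 y; rewrite -Ay !inE => /andP[].
Qed.

(** * Colourings alternating under two fixed-point-free involutions *)

Section Involutions.

Variables (T : finType) (a b : T -> T).
Hypotheses (aK : involutive a) (bK : involutive b).
Hypotheses (a_free : forall x, a x != x) (b_free : forall x, b x != x).

Let p := b \o a.

Let p_inj : injective p.
Proof. exact: inj_comp (inv_inj bK) (inv_inj aK). Qed.

Let iter_p_inj i : injective (iter i p).
Proof. by elim: i => // i IHi x y /= /p_inj/IHi. Qed.

Let iter_p_conj i x : iter i p (a (iter i p x)) = a x.
Proof.
by elim: i => // i IHi; rewrite iterSr iterS {2 3}/p /= aK bK.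
Qed.

(* In the dihedral action of [a] and [b], a relation [a x = p ^ i x] would    *)
(* give a fixed point of [a] (if [i] is even) or of [b] (if [i] is odd).      *)
Let not_fconnect x : ~~ fconnect p x (a x).
Proof.
apply/negP => /iter_findex; set i := findex _ _ _ => pi.
have [j ij] : exists j, i = j + j + odd i by exists i./2; lia.
move: pi; rewrite -(iter_p_conj j x) ij -addnA iterD => /(iter_p_inj).
case: (odd i); rewrite ?addn0 ?addn1 => /= /eqP; last first.
  by rewrite eq_sym (negPf (a_free _)).
by rewrite /p /= (negPf (b_free _)).
Qed.

(** Both a and b exchange the p-cycle of x with that of a x, because b x = p (a x). These two cycles
    are distinct, so comparing the ranks of their roots tells them apart. *)
Lemma involutions_2colouring :
  exists X : pred T, forall x, X (a x) = ~~ X x /\ X (b x) = ~~ X x.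
Proof.
have rootE x y : fconnect p x y -> froot p x = froot p y.
  by move=> /(fingraph.rootP (fconnect_sym p_inj)).
exists (fun x => enum_rank (froot p x) < enum_rank (froot p (a x))) => x.
have rb : froot p (b x) = froot p (a x).
  by rewrite -{1}(aK x); symmetry; apply/rootE/fconnect1.
have rab : froot p (a (b x)) = froot p x.
  have {2}<- : p (a (b x)) = x by have := iter_p_conj 1 (a x); rewrite /= /p /= !aK.
  exact/rootE/fconnect1.
rewrite rb rab aK; suff : enum_rank (froot p x) != enum_rank (froot p (a x)).
  by rewrite -val_eqE /=; lia.
rewrite (inj_eq enum_rank_inj) (root_connect (fconnect_sym p_inj)).
exact: not_fconnect.
Qed.

End Involutions.

(** Applied to flags, this gives the exchange of the two ends of an edge and the exchange of the two
    edges at a vertex. *)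
Lemma fiber2_involution (T : finType) (S : eqType) (h : T -> S) :
  (forall x, #|[set y | h y == h x]| = 2) ->
  exists a : T -> T, [/\ involutive a, forall x, a x != x,
    forall x, h (a x) = h x & forall x y, h y = h x -> y != x -> y = a x].
Proof.
move=> h2.
have /fin_all_exists[a aP] x : exists y, y != x /\ [set z | h z == h x] = [set x; y].
  by have [|y yx hy] := card2_other (h2 x) (x := x); [rewrite inE | exists y].
have ah x : h (a x) = h x.
  have [_ /setP/(_ (a x))] := aP x.
  by rewrite !inE eqxx orbT => /eqP.
have au x y : h y = h x -> y != x -> y = a x.
  move=> hyx /negPf yx; have [_ /setP/(_ y)] := aP x.
  by rewrite !inE hyx eqxx yx /= => /esym/eqP.
have af x : a x != x by case: (aP x).
by exists a; split=> // x; rewrite -(au (a x) x) // eq_sym.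
Qed.

(** * Double counting, and codegrees in the subdivision *)

Section Hypergraphs.

Variable H : hypergraph.

Local Notation edge := {e : {set vertex H} | e \in hyperedges H}.

Lemma codegreeC (u v : vertex H) : codegree u v = codegree v u.
Proof. by apply: eq_card => e; rewrite !inE [_ && (v \in e)]andbC. Qed.

Lemma codegree_diag (v : vertex H) : codegree v v = degree v.
Proof. by apply: eq_card => e; rewrite !inE andbb. Qed.

Lemma sum_codegree k (u : vertex H) :
  uniform k H -> \sum_v codegree u v = degree u * k.
Proof.
move=> Hk; rewrite /degree -sum_nat_const.
have cE v : codegree u v = \sum_(e in [set e in hyperedges H | u \in e]) (v \in e).
  rewrite /codegree -sum1_card big_mkcond [RHS]big_mkcond /=.
  by apply: eq_bigr => e _; rewrite !inE; do 3!case: (_ \in _).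
rewrite (eq_bigr _ (fun v _ => cE v)) exchange_big /=.
apply: eq_bigr => e; rewrite inE => /andP[eH _].
by rewrite -(Hk _ eH) -sum1_card [RHS]big_mkcond; apply: eq_bigr => v _; case: (_ \in _).
Qed.

Lemma sum_degree k : uniform k H -> \sum_v @degree H v = #|hyperedges H| * k.
Proof.
move=> Hk; rewrite -sum_nat_const.
have dE (v : vertex H) : degree v = \sum_(e in hyperedges H) (v \in e).
  rewrite /degree -sum1_card big_mkcond [RHS]big_mkcond /=.
  by apply: eq_bigr => e _; rewrite !inE; do 2!case: (_ \in _).
rewrite (eq_bigr _ (fun v _ => dE v)) exchange_big /=.
apply: eq_bigr => e eH.
by rewrite -(Hk _ eH) -sum1_card [RHS]big_mkcond; apply: eq_bigr => v _; case: (_ \in _).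
Qed.

Lemma card_regular k r : uniform k H -> (forall v : vertex H, degree v = r) ->
  #|vertex H| * r = #|hyperedges H| * k.
Proof.
by move=> Hk Hr; rewrite -(sum_degree Hk) (eq_bigr _ (fun v _ => Hr v)) sum_nat_const.
Qed.

Lemma card_edge : #|{: edge}| = #|hyperedges H|.
Proof. by rewrite card_sig; apply: eq_card. Qed.

Lemma mem_inl_sub_hyperedge (u w : vertex H) (e : edge) :
  (inl u \in sub_hyperedge e w) = (u != w) && (u \in val e).
Proof.
by rewrite in_setU1 /= mem_imset ?in_setD1 // => x y [].
Qed.

Lemma mem_inr_sub_hyperedge (w : vertex H) (e e' : edge) :
  (inr e' \in sub_hyperedge e w) = (e' == e).
Proof.
by rewrite in_setU1 -[RHS]orbF; congr (_ || _); apply/imsetP => -[].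
Qed.

(** The only new vertex of the hyperedge reveals e, and v is the only vertex of e missing from
    it. *)
Lemma sub_hyperedge_inj (e e' : edge) (v v' : vertex H) :
  v \in val e -> sub_hyperedge e v = sub_hyperedge e' v' -> (e, v) = (e', v').
Proof.
move=> ve /setP eq_f; have /eqP ee' : e == e'.
  by rewrite -(mem_inr_sub_hyperedge v') -eq_f mem_inr_sub_hyperedge.
rewrite {}ee' in ve eq_f *; congr (_, _); apply/eqP.
by have := eq_f (inl v); rewrite !mem_inl_sub_hyperedge eqxx ve andbT; case: eqVneq.
Qed.

(** By injectivity, hyperedges of S(H) correspond to pairs of a hyperedge e and an omitted vertex w
    of e, so they can be counted one e at a time. *)
Lemma card_sub_hyperedges (P : pred {set sub_vertex H}) :
  #|[set f in sub_hyperedges H | P f]| =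
  \sum_(e : edge) #|[set w in val e | P (sub_hyperedge e w)]|.
Proof.
have -> : [set f in sub_hyperedges H | P f] =
    [set sub_hyperedge p.1 p.2 |
       p in [set p : edge * vertex H | (p.2 \in val p.1) && P (sub_hyperedge p.1 p.2)]].
  apply/setP => f; rewrite inE; apply/andP/imsetP => [[/imset2P[e v _ ve ->] Pf]|].
    by exists (e, v); rewrite // inE ve.
  by case=> -[e v]; rewrite inE /= => /andP[ve Pf] ->; split=> //; apply: imset2_f.
rewrite card_in_imset; last first.
  by move=> [e v] [e' v']; rewrite !inE => /andP[/= ve _] _; apply: sub_hyperedge_inj.
under eq_bigr do rewrite -sum1dep_card.
by rewrite pair_big_dep /= -sum1dep_card.
Qed.

Variable k : nat.
Hypothesis Hk : uniform k H.

(** Each e containing u and v contributes one hyperedge per omitted w in e outside {u, v}. The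
    factor is thus k - 2 for distinct vertices and k - 1 on the diagonal. *)
Lemma codegree_sub_ll (u v : vertex H) :
  @codegree (subdivision H) (inl u) (inl v) = codegree u v * (k - (u != v).+1).
Proof.
rewrite /codegree card_sub_hyperedges -sum_nat_const.
pose F (e : {set vertex H}) := if (u \in e) && (v \in e) then k - (u != v).+1 else 0.
transitivity (\sum_(e in hyperedges H) F e); last first.
  by rewrite big_mkcond [RHS]big_mkcond; apply: eq_bigr => e _; rewrite !inE /F; case: (e \in _).
rewrite [RHS]big_sub; apply: eq_bigr => e _; rewrite /F.
case: ifP => [/andP[ue ve]|/negbT nuv].
  have -> : [set w in val e | (inl u \in sub_hyperedge e w) && (inl v \in sub_hyperedge e w)]
      = val e :\: [set u; v].
    apply/setP => w; rewrite [LHS]in_set !mem_inl_sub_hyperedge ue ve !andbT !inE.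
    by rewrite [LHS]andbC negb_or ![_ == w]eq_sym.
  have /setIidPr uv_e : [set u; v] \subset val e by rewrite subUset !sub1set ue.
  by rewrite cardsD uv_e cards2 (Hk (valP e)).
apply/eqP; rewrite cards_eq0; apply/eqP/setP => w; rewrite [LHS]in_set in_set0 !mem_inl_sub_hyperedge.
by move: nuv; do 3!case: (_ \in _); rewrite /= ?andbF.
Qed.

Lemma codegree_sub_lr (u : vertex H) (e : edge) :
  @codegree (subdivision H) (inl u) (inr e) = (u \in val e) * k.-1.
Proof.
rewrite /codegree card_sub_hyperedges (bigD1 e) //= big1 ?addn0 => [|e' /negPf ne].
  have [ue|nue] := boolP (u \in val e).
    rewrite mul1n -(Hk (valP e)) (cardsD1 u (val e)) ue /=; apply: eq_card => w.
    by rewrite [LHS]in_set mem_inl_sub_hyperedge mem_inr_sub_hyperedge in_setD1 eqxx ue !andbT eq_sym andbC.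
  apply/eqP; rewrite mul0n cards_eq0; apply/eqP/setP => w.
  by rewrite [LHS]in_set in_set0 mem_inl_sub_hyperedge (negPf nue) !andbF.
apply/eqP; rewrite cards_eq0; apply/eqP/setP => w.
by rewrite [LHS]in_set in_set0 mem_inr_sub_hyperedge eq_sym ne !andbF.
Qed.

Lemma codegree_sub_rr (e e' : edge) :
  @codegree (subdivision H) (inr e) (inr e') = (e == e') * k.
Proof.
rewrite /codegree card_sub_hyperedges (bigD1 e) //= big1 ?addn0 => [|e'' /negPf ne].
  have [<-|nee] := eqVneq e e'.
    rewrite mul1n -(Hk (valP e)); apply: eq_card => w.
    by rewrite [LHS]in_set mem_inr_sub_hyperedge eqxx !andbT.
  apply/eqP; rewrite mul0n cards_eq0; apply/eqP/setP => w.
  by rewrite [LHS]in_set in_set0 !mem_inr_sub_hyperedge [e' == e]eq_sym (negPf nee) !andbF.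
apply/eqP; rewrite cards_eq0; apply/eqP/setP => w.
by rewrite [LHS]in_set in_set0 mem_inr_sub_hyperedge eq_sym ne !andbF.
Qed.

End Hypergraphs.

Local Notation edge H := {e : {set vertex H} | e \in hyperedges H}.

(** * Isomorphisms, and choosing ends of edges *)

Lemma codegree_iso (H H' : hypergraph) (f : vertex H -> vertex H') :
  bijective f ->
  (forall e : {set vertex H}, (f @: e \in hyperedges H') = (e \in hyperedges H)) ->
  forall u v, codegree (f u) (f v) = codegree u v.
Proof.
move=> bij_f fE u v; have inj_f := bij_inj bij_f; case: (bij_f) => f' fK f'K.
rewrite /codegree -[RHS](card_imset _ (imset_inj inj_f)).
have f_onto (e' : {set vertex H'}) : exists e : {set vertex H}, e' = f @: e.
  by exists (f' @: e'); rewrite -imset_comp (eq_imset (g := id)) ?imset_id.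
apply: eq_card => e'; apply/idP/imsetP => [|[e]].
  have [e ->] := f_onto e'.
  by rewrite inE fE !mem_imset // => eP; exists e; rewrite ?inE.
by rewrite !inE => eP ->; rewrite fE !mem_imset.
Qed.

(** Equal finite cardinalities make the injection on hyperedges onto, which yields the converse
    implication. *)
Lemma isomorphic_inj (H H' : hypergraph) (g : vertex H -> vertex H') :
  injective g -> (forall e, e \in hyperedges H -> g @: e \in hyperedges H') ->
  #|vertex H| = #|vertex H'| -> #|hyperedges H| = #|hyperedges H'| ->
  isomorphic H H'.
Proof.
move=> inj_g gE cV cE; exists g; first by apply: inj_card_bij; rewrite ?cV.
have imE : [set g @: (e : {set _}) | e in hyperedges H] = hyperedges H'.
  apply/eqP; rewrite eqEcard card_imset ?cE ?leqnn ?andbT; last exact: imset_inj.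
  by apply/subsetP => _ /imsetP[e eH ->]; apply: gE.
by move=> e; rewrite -imE mem_imset //; apply: imset_inj.
Qed.

(* For graphs this is an orientation making every component a directed cycle. *)
Lemma edge_transversal (H : hypergraph) :
  uniform 2 H -> (forall v : vertex H, degree v = 2) ->
  exists2 t : edge H -> vertex H, injective t & forall e, t e \in val e.
Proof.
move=> H2 d2; pose flag := {p : vertex H * edge H | p.1 \in val p.2}.
pose mkflag v (e : edge H) (ve : v \in val e) : flag := exist _ (v, e) ve.
have flag_inj (x y : flag) : (val x).1 = (val y).1 -> (val x).2 = (val y).2 -> x = y.
  by move=> h1 h2; apply: val_inj; case: (val x) (val y) h1 h2 => [??] [??] /= -> ->.
have fib2 (x : flag) : #|[set y : flag | (val y).2 == (val x).2]| = 2.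
  rewrite -(H2 _ (valP (val x).2)).
  rewrite -(@card_in_imset _ _ (fun y : flag => (val y).1)); last first.
    by move=> y z; rewrite !inE => /eqP y2 /eqP z2 yz; apply: flag_inj; rewrite ?y2 ?z2.
  apply: eq_card => v; apply/imsetP/idP => [[y]|ve].
    by rewrite inE => /eqP <- ->; exact: (valP y).
  by exists (mkflag v (val x).2 ve); rewrite ?inE.
have fib1 (x : flag) : #|[set y : flag | (val y).1 == (val x).1]| = 2.
  rewrite -(d2 (val x).1).
  rewrite -(@card_in_imset _ _ (fun y : flag => val (val y).2)); last first.
    move=> y z; rewrite !inE => /eqP y2 /eqP z2 /val_inj yz.
    by apply: flag_inj; rewrite ?y2 ?z2.
  apply: eq_card => e; apply/imsetP/idP => [[y]|].
    by rewrite !inE => /eqP <- ->; rewrite (valP (val y).2) (valP y).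
  by rewrite inE => /andP[eH ve]; exists (mkflag (val x).1 (Sub e eH) ve); rewrite ?inE.
(* [a] moves to the other end of the edge, [b] to the other edge at the vertex. As both reverse the
   colour, every edge has a flag coloured by [X], which defines [t], and no vertex has two, so [t]
   is injective. *)
have [a [aK a_free ah au]] := fiber2_involution fib2.
have [b [bK b_free bh bu]] := fiber2_involution fib1.
have [X XP] := involutions_2colouring aK bK a_free b_free.
have /fin_all_exists[t tP] (e : edge H) : exists v, exists ve : v \in val e, X (mkflag v e ve).
  have /card_gt0P[v ve] : 0 < #|val e| by rewrite H2 //; apply: valP.
  have xP (x : flag) : (val x).2 = e -> X x -> exists v, exists ve : v \in val e, X (mkflag v e ve).
    by case: x => -[w e1] we /= e1e; subst e1 => Xw; exists w, we.
  have [Xx|nXx] := boolP (X (mkflag v e ve)); first exact: (xP _ _ Xx).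
  by apply: (xP (a (mkflag v e ve))); rewrite ?ah //; case: (XP (mkflag v e ve)) => ->.
exists t => [e1 e2 t12|e]; last by case: (tP e).
have [[h1 X1] [h2 X2]] := (tP e1, tP e2).
have [/(congr1 (fun x : flag => (val x).2)) //|ne] := eqVneq (mkflag _ _ h1) (mkflag _ _ h2).
move: X1; rewrite (bu (mkflag _ _ h2) (mkflag _ _ h1)) //.
by have [_ ->] := XP (mkflag _ _ h2); rewrite X2.
Qed.

(** * Recovering the hypergraph from its subdivision *)

Section Reconstruction.

Variables (k r : nat) (H H' : hypergraph).
Hypotheses (k2 : 2 <= k) (Hk : uniform k H) (Hk' : uniform k H').
Hypotheses (Hr : forall v : vertex H, degree v = r).
Hypotheses (Hr' : forall v : vertex H', degree v = r).
Variable f : sub_vertex H -> sub_vertex H'.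
Hypothesis f_bij : bijective f.
Hypothesis f_codegree : forall x y,
  @codegree (subdivision H') (f x) (f y) = @codegree (subdivision H) x y.

Let f_inj := bij_inj f_bij.

(** From n r = m k follows n (k + r) = (n + m) k, so the order n + m of S(H) fixes n, and then m. *)
Lemma card_subdivision_iso :
  #|vertex H| = #|vertex H'| /\ #|hyperedges H| = #|hyperedges H'|.
Proof.
have := bij_eq_card f_bij; rewrite /= !card_sum !card_edge => cVE.
have cV : #|vertex H| = #|vertex H'|.
  apply/eqP; rewrite -(@eqn_pmul2r (k + r)) ?addn_gt0 ?(ltnW k2) //; apply/eqP.
  rewrite !mulnDr (card_regular Hk Hr) (card_regular Hk' Hr').
  by rewrite -!mulnDl cVE.
by split=> //; move: cVE; rewrite cV => /addnI.
Qed.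

(** An old vertex with a new image p_e' is brought back to an old one by [t]: an arbitrary choice of
    members in the generic case, the injective transversal in the case of cycles. *)
Let g (t : edge H' -> vertex H') v :=
  match f (inl v) with inl w => w | inr e' => t e' end.

Let isoP t : injective (g t) ->
  (forall e, e \in hyperedges H -> g t @: e \in hyperedges H') -> isomorphic H H'.
Proof. by have [? ?] := card_subdivision_iso; move=> *; apply: (isomorphic_inj (g := g t)). Qed.

Let edge_image t (e : edge H) (e' : edge H') : injective (g t) ->
  (forall v, v \in val e -> exists2 w, f (inl v) = inl w & w \in val e') ->
  g t @: val e = val e'.
Proof.
move=> g_inj fe; apply/eqP; rewrite eqEcard card_imset //.
rewrite (Hk (valP e)) (Hk' (valP e')) leqnn andbT.
by apply/subsetP => _ /imsetP[v /fe[w fv we] ->]; rewrite /g fv.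
Qed.

Lemma reconstruct_generic : r * k.-1 != k -> isomorphic H H'.
Proof.
move=> rk.
have fl v : exists w, f (inl v) = inl w.
  case fv : (f (inl v)) => [w|e']; first by exists w.
  have := f_codegree (inl v) (inl v); rewrite fv (codegree_sub_ll Hk) (codegree_sub_rr Hk').
  by rewrite !eqxx mul1n codegree_diag Hr subn1 => /esym/eqP; rewrite (negPf rk).
have fr e : exists e', f (inr e) = inr e'.
  case fv : (f (inr e)) => [w|e']; last by exists e'.
  have := f_codegree (inr e) (inr e); rewrite fv (codegree_sub_ll Hk') (codegree_sub_rr Hk).
  by rewrite !eqxx mul1n codegree_diag Hr' subn1 => /eqP; rewrite (negPf rk).
have /fin_all_exists[t _] (e' : edge H') : exists v, v \in val e'.
  by apply/card_gt0P; rewrite (Hk' (valP e')) ltnW.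
have g_inj : injective (g t).
  move=> u v; rewrite /g; have [[u' fu] [v' fv]] := (fl u, fl v).
  by rewrite fu fv => uv; move: fu; rewrite uv -fv => /f_inj[].
apply: (isoP g_inj) => e eH; have [e' fe] := fr (Sub e eH).
rewrite (edge_image (e := Sub e eH) (e' := e') g_inj) ?(valP e') // => v ve.
have [w fv] := fl v; exists w => //.
(* The codegree of v and p_e is k - 1 > 0, and it would be 0 if w were outside e'. *)
have := f_codegree (inl v) (inr (Sub e eH)).
rewrite fe fv (codegree_sub_lr Hk) (codegree_sub_lr Hk') /= ve.
by case: (_ \in _) => //; lia.
Qed.

(* Here S(H) is a union of even cycles, and f may exchange old and new        *)
(* vertices on some of them; there, e' is replaced by its chosen end t e'.    *)
Lemma reconstruct_cycles : k = 2 -> r = 2 -> isomorphic H H'.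
Proof.
move=> kE rE; move: (Hr) (Hr') (Hk) (Hk'); rewrite rE kE => d2 d2' u2 u2'.
have [t t_inj tP] := edge_transversal u2' d2'.
have ll := codegree_sub_ll u2; have ll' := codegree_sub_ll u2'.
have lr := codegree_sub_lr u2; have lr' := codegree_sub_lr u2'.
have rr := codegree_sub_rr u2; have rr' := codegree_sub_rr u2'.
have far u v : u != v -> @codegree (subdivision H') (f (inl u)) (f (inl v)) = 0.
  by move=> uv; rewrite f_codegree ll uv muln0.
(* Distinct old vertices are non-adjacent in S(H), hence so are their images. An image w equal to t
   e for another image p_e would be adjacent to p_e, since t e lies in e. *)
have g_inj : injective (g t).
  move=> u v; rewrite /g; apply: contra_eq => /[dup] uv /far.
  have fuv : f (inl u) != f (inl v) by rewrite (inj_eq f_inj); apply: contra_neq uv => -[].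
  case: (f (inl u)) (f (inl v)) fuv => [u'|e1] [v'|e2] fuv.
  - by move=> _; apply: contra_neq fuv => ->.
  - by rewrite lr'; case: eqP => // ->; rewrite tP.
  - by rewrite codegreeC lr'; case: eqP => // <-; rewrite tP.
  by move=> _; rewrite (inj_eq t_inj); apply: contra_neq fuv => ->.
(* For k = r = 2 there are as many edges as vertices, so [t] is a bijection. *)
have t_onto w : exists e, w = t e.
  have /codomP[] : w \in codom t; last by move=> e ->; exists e.
  apply: (inj_card_onto t_inj); rewrite card_edge.
  by have := card_regular u2' d2'; lia.
have near (e : edge H) v : v \in val e ->
    @codegree (subdivision H') (f (inl v)) (f (inr e)) = 1.
  by move=> ve; rewrite f_codegree lr ve.
apply: (isoP g_inj) => e0 eH; pose e : edge H := Sub e0 eH.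
rewrite -[e0]/(val e); have := near e; case fe: (f (inr e)) => [w|e'] nearf; last first.
  rewrite (edge_image (e' := e') g_inj) ?(valP e') // => v /nearf.
  case fv: (f (inl v)) => [w|e1]; last by rewrite rr'; case: (_ == _).
  by rewrite lr'; case we': (w \in _) => // _; exists w.
(* From here on p_e is sent to an old vertex w, so the ends of e go to new vertices of edges at
   w. *)
have swap v : v \in val e -> exists2 e1, f (inl v) = inr e1 & w \in val e1.
  move/nearf; case fv: (f (inl v)) => [v'|e1].
    by rewrite ll'; have [<-|] := eqVneq v' w; rewrite ?muln0 // codegree_diag d2'.
  by rewrite codegreeC lr'; case we1: (w \in _) => // _; exists e1.
have [u0 [v0 [uv0 eE]]] : exists u v, u != v /\ val e = [set u; v].
  by apply/cards2P; rewrite u2 ?(valP e).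
(* If w is the chosen end of e1, the ends of e go to w and to t e2. Both lie in e2 and they differ,
   so the image of e is exactly e2. *)
have half u v e1 : val e = [set u; v] -> u != v -> f (inl u) = inr e1 -> w = t e1 ->
    g t @: val e \in hyperedges H'.
  move=> euv uv fu wt.
  have [e2 fv we2] : exists2 e2, f (inl v) = inr e2 & w \in val e2.
    by apply: swap; rewrite euv !inE eqxx orbT.
  have wte2 : t e2 != w.
    rewrite wt (inj_eq t_inj); apply: contra_neq uv => e21.
    by move: fv; rewrite e21 -fu => /f_inj[].
  have [w2 w2w e2E] := card2_other (u2' _ (valP e2)) we2.
  suff -> : g t @: val e = val e2 by apply: valP.
  rewrite euv imsetU !imset_set1 /g fu fv -wt e2E; congr (_ |: [set _]).
  by have := tP e2; rewrite e2E !inE (negPf wte2) => /eqP.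
have [e1 fu0 we1] : exists2 e1, f (inl u0) = inr e1 & w \in val e1.
  by apply: swap; rewrite eE !inE eqxx.
have [e2 fv0 we2] : exists2 e2, f (inl v0) = inr e2 & w \in val e2.
  by apply: swap; rewrite eE !inE eqxx orbT.
have e12 : e1 != e2.
  by apply: contra_neq uv0 => e12; move: fu0; rewrite e12 -fv0 => /f_inj[].
(* The edge choosing w contains w, so it is one of the two edges e1, e2 at w; [half] then applies,
   with u0 and v0 exchanged in the second case. *)
have [e3 we3] := t_onto w.
have [x xe1 Ew] : exists2 x, x != val e1 & [set e in hyperedges H' | w \in e] = [set val e1; x].
  by apply: (card2_other (d2' w)); rewrite inE we1 andbT; apply: (valP e1).
have inEw (d : edge H') : w \in val d -> (val d == val e1) || (val d == x).
  by move=> wd; rewrite -in_set2 -Ew inE wd andbT; apply: (valP d).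
have [e31|ne31] := eqVneq e3 e1; first by apply: half eE uv0 fu0 _; rewrite -e31.
have e32 : e3 = e2.
  have := inEw e3; rewrite {1}we3 tP => /(_ isT).
  have := inEw _ we2; rewrite !(inj_eq val_inj) (negPf ne31) [e2 == e1]eq_sym (negPf e12) /=.
  by move=> /eqP e2x /eqP e3x; exact: val_inj (etrans e3x (esym e2x)).
apply: (half v0 u0 e2); rewrite // 1?eq_sym // -?e32 //.
by rewrite eE setUC.
Qed.

End Reconstruction.

Lemma isomorphic_subdivision (k r : nat) (H H' : hypergraph) :
  2 <= k -> uniform k H -> uniform k H' ->
  (forall v : vertex H, degree v = r) -> (forall v : vertex H', degree v = r) ->
  isomorphic (subdivision H) (subdivision H') -> isomorphic H H'.
Proof.
move=> k2 Hk Hk' Hr Hr' [f f_bij /(codegree_iso f_bij) f_codegree].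
have [rk|rk] := eqVneq (r * k.-1) k; last exact: (reconstruct_generic k2 Hk Hk' Hr Hr' f_bij).
(* From r (k - 1) = k, k - 1 divides k and hence equals 1. *)
suff [k_2 r_2] : k = 2 /\ r = 2 by apply: (reconstruct_cycles k2 Hk Hk' Hr Hr' f_bij).
by case: k k2 rk {Hk Hk'} => [|[|k]] // _; case: r {Hr Hr'} => [|[|[|r]]] /=; nia.
Qed.

(** * Determinants and identities of polynomials *)

Section LinearAlgebra.

Local Open Scope ring_scope.

Import Order.TTheory GRing.Theory Num.Theory.

(** Relates the enumeration of the sum type [sub_vertex] to block indices in n + m; the two index
    bounds are equal only propositionally. *)
Lemma det_reindex (R : comNzRingType) n n' (h : 'I_n -> 'I_n') (M : 'M[R]_n') :
  bijective h -> \det (\matrix_(i, j) M (h i) (h j)) = \det M.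
Proof.
move=> h_bij; have nn' : n = n' by have := bij_eq_card h_bij; rewrite !card_ord.
subst n'; pose s := perm (bij_inj h_bij).
have -> : \matrix_(i, j) M (h i) (h j) = row_perm s (col_perm s M).
  by apply/matrixP => i j; rewrite !mxE !permE.
rewrite row_permE col_permE !det_mulmx !det_perm odd_permV mulrCA mulrA.
by rewrite -mulrA -signr_addb addbb mulr1.
Qed.

Lemma horner_char_poly (R : comNzRingType) n (A : 'M[R]_n) (c : R) :
  (char_poly A).[c] = \det (c%:M - A).
Proof.
rewrite -horner_evalE /char_poly -det_map_mx; congr (\det _).
by apply/matrixP => i j; rewrite !mxE /= /horner_eval hornerD hornerN hornerC hornerMn hornerX.
Qed.

(* Schur complement of the lower right block. *)
Lemma det_block_scalar (F : fieldType) n m (M : 'M[F]_n) (B : 'M[F]_(n, m)) (c : F) :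
  c != 0 ->
  \det (block_mx M (- B) (- B^T) c%:M) * c ^+ n = \det (c *: M - B *m B^T) * c ^+ m.
Proof.
move=> c0.
have /(congr1 determinant) : block_mx M (- B) (- B^T) c%:M *m block_mx 1%:M 0 (c^-1 *: B^T) 1%:M
    = block_mx (c^-1 *: (c *: M - B *m B^T)) (- B) 0 c%:M.
  rewrite mulmx_block !mulmx1 !mulmx0 !add0r mulNmx -scalemxAr mul_scalar_mx scalerA.
  by rewrite divff // scale1r addNr scalerBr scalerA mulVf // scale1r.
rewrite det_mulmx det_lblock !det1 !mulr1 det_ublock detZ det_scalar => ->.
by rewrite exprVn -(mulrA _ _ (c ^+ m)) mulrAC mulVf ?expf_neq0 // mul1r.
Qed.

Lemma poly_eq_cofinite (F : numFieldType) (p q d : {poly F}) :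
  d != 0 -> (forall c, d.[c] != 0 -> p.[c] = q.[c]) -> p = q.
Proof.
move=> d0 pq; apply/eqP; rewrite -subr_eq0.
suff /eqP : (p - q) * d = 0 by rewrite mulf_eq0 (negPf d0) orbF.
pose N := size ((p - q) * d).
(* The product (p - q) d vanishes everywhere; in characteristic zero the numbers 0, ..., N - 1 are N
   distinct roots, too many for size N unless it is zero. *)
apply: (@roots_geq_poly_eq0 _ _ [seq i%:R | i <- iota 0 N]).
- apply/allP => c _; rewrite /root hornerM hornerD hornerN.
  by have [->|/pq ->] := eqVneq d.[c] 0; rewrite ?mulr0 ?subrr ?mul0r.
- by rewrite map_inj_uniq ?iota_uniq // => i j /eqP; rewrite eqr_nat => /eqP.
by rewrite size_map size_iota.
Qed.

Lemma eq_mup_monic (F : closedFieldType) (p q : {poly F}) :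
  p \is monic -> q \is monic -> (forall a, mup a p = mup a q) -> p = q.
Proof.
move=> /monicP p1 /monicP q1; have [s ->] := closed_field_poly_normal p.
have [t ->] := closed_field_poly_normal q; rewrite p1 q1 !scale1r => st.
by apply: perm_big; apply/allP => a _ /=; rewrite -!mu_prod_XsubC st.
Qed.

Lemma cospectral_char_poly k (H H' : hypergraph) :
  cospectral k H H' -> char_poly (adjacency k H) = char_poly (adjacency k H').
Proof. by move=> HH'; apply: eq_mup_monic; rewrite ?char_poly_monic. Qed.

(** * The spectrum of a regular uniform hypergraph and of its subdivision *)

Section Spectrum.

Variables (k r : nat) (H : hypergraph).
Hypotheses (k2 : (2 <= k)%N) (Hk : uniform k H).
Hypothesis Hr : forall v : vertex H, degree v = r.

Local Notation A := (adjacency k H).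
Local Notation n := #|vertex H|.
Local Notation m := #|{: edge H}|.

Let k1_neq0 : k.-1%:R != 0 :> algC.
Proof. by rewrite pnatr_eq0; lia. Qed.

Lemma adjacency_ge0 i j : 0 <= A i j.
Proof. by rewrite mxE; case: eqP => // _; rewrite divr_ge0 ?ler0n. Qed.

Lemma adjacencyC i j : A i j = A j i.
Proof. by rewrite !mxE eq_sym codegreeC. Qed.

Lemma sum_adjacency j : \sum_i A i j = r%:R.
Proof.
apply: (mulIf k1_neq0); rewrite mulr_suml -natrM.
have := sum_codegree (enum_val j) Hk; rewrite Hr.
rewrite (reindex (fun i : 'I_n => enum_val i)) /=; last exact/onW_bij/enum_val_bij.
rewrite (bigD1 j) //= codegree_diag Hr => sE.
(* The full row of codegrees sums to r k; its diagonal term is r, while A has 0 there. *)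
have -> : (r * k.-1 = \sum_(i | i != j) codegree (enum_val j) (enum_val i))%N.
  by apply: (@addnI r); rewrite sE -mulnS prednK // ltnW.
rewrite (bigD1 j) //= mxE eqxx mul0r add0r natr_sum; apply: eq_bigr => i /negPf ij.
by rewrite mxE ij divfK // codegreeC.
Qed.

Lemma eigenvalue_degree : (0 < n)%N -> eigenvalue A r%:R.
Proof.
move=> n0; apply/eigenvalueP; exists (const_mx 1).
  apply/rowP => j; rewrite !mxE mulr1 -(sum_adjacency j).
  by apply: eq_bigr => i _; rewrite mxE mul1r.
by apply/eqP => /rowP/(_ (Ordinal n0)) /eqP; rewrite !mxE oner_eq0.
Qed.

(** Since A is nonnegative with all row sums r, multiplication by A increases the l1 norm of a
    vector at most r times. *)
Lemma eigenvalue_le_degree a : eigenvalue A a -> `|a| <= r%:R.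
Proof.
case/eigenvalueP => v vA /rV0Pn[j0 vj0].
have v_gt0 : 0 < \sum_j `|v 0 j|.
  by rewrite (bigD1 j0) //= ltr_wpDr ?normr_gt0 // sumr_ge0.
rewrite -(ler_pM2r v_gt0) !mulr_sumr.
have -> : \sum_j `|a| * `|v 0 j| = \sum_j `|(v *m A) 0 j|.
  by apply: eq_bigr => j _; rewrite vA mxE normrM.
apply: (@le_trans _ _ (\sum_j \sum_i `|v 0 i| * A i j)).
  apply: ler_sum => j _; rewrite mxE; apply: le_trans (ler_norm_sum _ _ _) _.
  by apply: ler_sum => i _; rewrite normrM (ger0_norm (adjacency_ge0 _ _)).
rewrite exchange_big; apply: ler_sum => i _ /=.
under eq_bigr do rewrite adjacencyC.
by rewrite -mulr_sumr sum_adjacency mulrC.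
Qed.

Definition incidence : 'M[algC]_(n, m) :=
  \matrix_(i, j) (enum_val i \in val (enum_val j : edge H))%:R.

Lemma incidence_mul_tr : incidence *m incidence^T = r%:R%:M + k.-1%:R *: A.
Proof.
apply/matrixP => i j; rewrite !mxE.
have -> : \sum_l incidence i l * incidence^T l j = (codegree (enum_val i) (enum_val j))%:R.
  have -> : codegree (enum_val i) (enum_val j) =
      (\sum_(e : edge H) (enum_val i \in val e) * (enum_val j \in val e))%N.
    rewrite /codegree -sum1_card -(big_sub (mem (hyperedges H)) (fun e : {set vertex H} =>
      (enum_val i \in e) * (enum_val j \in e))%N).
    rewrite big_mkcond [RHS]big_mkcond; apply: eq_bigr => e _.
    by rewrite !inE; do 3!case: (_ \in _).
  rewrite natr_sum (reindex (fun i : 'I_m => enum_val i)) /=; last exact/onW_bij/enum_val_bij.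
  by apply: eq_bigr => l _; rewrite !mxE natrM.
have [->|ij] := eqVneq i j; first by rewrite codegree_diag Hr mulr0 addr0.
by rewrite mulr0n add0r mulrC divfK.
Qed.

Let split_vertex (i : 'I_(n + m)) : sub_vertex H :=
  match split i with inl a => inl (enum_val a) | inr b => inr (enum_val b) end.

Let split_vertex_bij : bijective split_vertex.
Proof.
exists (fun x => unsplit (match x with inl v => inl (enum_rank v) | inr e => inr (enum_rank e) end)).
  by move=> i; rewrite -[RHS]splitK /split_vertex; case: (split i) => a; rewrite enum_valK.
by case=> x; rewrite /split_vertex unsplitK enum_rankK.
Qed.

Let split_vertexl i : split_vertex (lshift m i) = inl (enum_val i).
Proof. by rewrite /split_vertex (unsplitK (inl _ i)). Qed.

Let split_vertexr i : split_vertex (rshift n i) = inr (enum_val i).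
Proof. by rewrite /split_vertex (unsplitK (inr _ i)). Qed.

Lemma horner_char_poly_subdivision (c : algC) :
  (char_poly (adjacency k (subdivision H))).[c] =
  \det (block_mx (c%:M - (k - 2)%:R *: A) (- incidence) (- incidence^T) c%:M).
Proof.
rewrite horner_char_poly.
rewrite -(@det_reindex _ _ _ (fun i => enum_rank (split_vertex i))); last first.
  exact: bij_comp (enum_rank_bij _) split_vertex_bij.
pose simplE := (inj_eq enum_rank_inj, enum_rankK, inj_eq (bij_inj split_vertex_bij)).
congr (\det _); apply/matrixP => i j.
case: (split_ordP i) => i' -> {i}; case: (split_ordP j) => j' -> {j}; move: i' j' => i j.
- rewrite block_mxEul !mxE !simplE !split_vertexl (codegree_sub_ll Hk) (inj_eq (@lshift_inj _ _)).
  have [_|ij] := eqVneq i j; first by rewrite mulr0.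
  by rewrite (inj_eq enum_val_inj) ij natrM mulrAC mulrC.
- rewrite block_mxEur !mxE !simplE split_vertexl split_vertexr (codegree_sub_lr Hk) eq_lrshift.
  by rewrite mulr0n sub0r natrM mulfK.
- rewrite block_mxEdl !mxE !simplE split_vertexl split_vertexr codegreeC (codegree_sub_lr Hk).
  by rewrite eq_rlshift mulr0n sub0r natrM mulfK.
rewrite block_mxEdr !mxE !simplE !split_vertexr (codegree_sub_rr Hk) (inj_eq (@rshift_inj _ _)).
have [_|ij] := eqVneq i j; first by rewrite subr0.
by rewrite (inj_eq enum_val_inj) (negPf ij) mul0r subr0.
Qed.

(** The Schur complement is c (c I - (k - 2) A) - B B^T = (c^2 - r) I - s A, from which s is
    factored out. Keeping powers of c on both sides avoids the exponent m - n, which may be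
    negative. *)
Lemma char_poly_subdivision (c : algC) (s := c * (k - 2)%:R + k.-1%:R) :
  c != 0 -> s != 0 ->
  (char_poly (adjacency k (subdivision H))).[c] * c ^+ n =
  s ^+ n * (char_poly A).[(c ^+ 2 - r%:R) / s] * c ^+ m.
Proof.
move=> c0 s0; rewrite horner_char_poly_subdivision det_block_scalar //.
congr (_ * _); rewrite horner_char_poly -detZ; congr (\det _).
rewrite incidence_mul_tr; apply/matrixP => i j; rewrite !(mxE, mulrb).
by have [_|_] := boolP (i == j); rewrite /s; field.
Qed.

End Spectrum.

(** * Cospectrality passes to subdivisions *)

Lemma cospectral_degree k (H H' : hypergraph) :
  (2 <= k)%N -> uniform k H -> uniform k H' -> regular H -> regular H' ->
  cospectral k H H' ->
  exists r, (forall v : vertex H, degree v = r) /\ (forall v : vertex H', degree v = r).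
Proof.
move=> k2 Hk Hk' [r Hr] [r' Hr'] HH'.
have eig a : eigenvalue (adjacency k H) a = eigenvalue (adjacency k H') a.
  by rewrite -!eigen_mult_gt0 HH'.
have cV : #|vertex H| = #|vertex H'|.
  by apply: succn_inj; rewrite -!(size_char_poly (adjacency k _)) (cospectral_char_poly HH').
have [n0|n_gt0] := posnP #|vertex H|.
  by exists 0%N; split=> v; case: (fintype0 v); rewrite -?cV.
(* Each degree is an eigenvalue of its own matrix, hence of the other, where it is bounded by the
   other degree. *)
suff rr' : r = r' by exists r; split=> //; rewrite rr'.
apply/eqP; rewrite eqn_leq -!(ler_nat algC).
rewrite -[r%:R in X in X && _]normr_nat -[r'%:R in X in _ && X]normr_nat.
apply/andP; split.
  by apply: (eigenvalue_le_degree k2 Hk' Hr'); rewrite -eig (eigenvalue_degree k2 Hk Hr).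
by apply: (eigenvalue_le_degree k2 Hk Hr); rewrite eig (eigenvalue_degree k2 Hk' Hr') -?cV.
Qed.

Lemma cospectral_subdivision k r (H H' : hypergraph) :
  (2 <= k)%N -> uniform k H -> uniform k H' ->
  (forall v : vertex H, degree v = r) -> (forall v : vertex H', degree v = r) ->
  cospectral k H H' -> cospectral k (subdivision H) (subdivision H').
Proof.
move=> k2 Hk Hk' Hr Hr' /cospectral_char_poly pHH' a; rewrite /eigen_mult; congr mup.
have cV : #|vertex H| = #|vertex H'|.
  by apply: succn_inj; rewrite -!(size_char_poly (adjacency k _)) pHH'.
have cE : #|{: edge H}| = #|{: edge H'}|.
  rewrite !card_edge; apply/eqP; rewrite -(eqn_pmul2r (ltnW k2)).
  by rewrite -(card_regular Hk Hr) -(card_regular Hk' Hr') cV.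
(* The roots of d are the points excluded by [char_poly_subdivision], where c = 0 or s = 0. *)
pose d : {poly algC} := 'X * ((k - 2)%:R *: 'X + k.-1%:R%:P).
apply: (@poly_eq_cofinite _ _ _ d) => [|c].
  rewrite mulf_neq0 ?polyX_eq0 //; apply/eqP => /(congr1 (horner^~ 0))/eqP.
  by rewrite !hornerE pnatr_eq0; lia.
rewrite !hornerE [_ * c]mulrC mulf_eq0 negb_or => /andP[c0 s0].
apply: (mulIf (expf_neq0 #|vertex H| c0)).
rewrite (char_poly_subdivision k2 Hk Hr c0 s0) pHH' cV.
by rewrite (char_poly_subdivision k2 Hk' Hr' c0 s0) cE.
Qed.

End LinearAlgebra.

Theorem theorem7 (k : nat) (hk : 2 <= k) (H H' : hypergraph)
    (Hk : uniform k H) (Hk' : uniform k H')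
    (Hreg : regular H) (Hreg' : regular H')
    (Hniso : ~ isomorphic H H') (Hcosp : cospectral k H H') :
  ~ isomorphic (subdivision H) (subdivision H') /\
  cospectral k (subdivision H) (subdivision H').
Proof.
have [r [Hr Hr']] := cospectral_degree hk Hk Hk' Hreg Hreg' Hcosp.
split; last exact: (cospectral_subdivision hk Hk Hk' Hr Hr' Hcosp).
by move/(isomorphic_subdivision hk Hk Hk' Hr Hr').
Qed.
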